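(* Let $G$ be a finite nilpotent group. Then $\Gamma(G)$ is bipartite if and only if $G$ is a cyclic group of order $p^a$ or $p^aq^b$, for some distinct primes $p,q$ and some integers $a,b\geq 0$.
   Context: For a group $G$, the co-maximal subgroup graph $\Gamma(G)$ is the simple undirected graph whose vertices are the non-trivial proper subgroups of $G$, two distinct vertices $H,K$ being adjacent if and only if $HK=G$, where $HK=\{hk : h\in H, k\in K\}$. A graph is bipartite if its vertex set can be partitioned into two (possibly empty) independent sets; in particular edgeless graphs, including the graph with no vertices, are bipartite. *)

(* Defs.v *)
From mathcomp Require Import all_boot all_fingroup all_solvable.

Set Implicit Arguments.
Unset Strict Implicit.
Unset Printing Implicit Defensive.

Import GroupScope.

(* A finite simple graph is given by a symmetric irreflexive relation e on a  *)
(* finType T of vertices.                                                     *)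

Definition independent (T : finType) (e : rel T) (A : {set T}) : Prop :=
  forall x y : T, x \in A -> y \in A -> ~~ e x y.

(* The parts may be empty, which is why this is not stated with finset's      *)
(* partition, whose blocks are nonempty.                                      *)
Definition bipartite (T : finType) (e : rel T) : Prop :=
  exists A B : {set T},
    [/\ A :|: B = [set: T], [disjoint A & B], independent e A
      & independent e B].

Section ComaximalSubgroupGraph.

Variables (gT : finGroupType) (G : {group gT}).

Definition comax_vertex : finType :=
  {H : {group gT} | (H :!=: 1) && (H \proper G)}.

(* val H * val K is the setwise product HK, not the generated subgroup.       *)
Definition comax_adj : rel comax_vertex :=
  fun H K => (H != K) && (val H * val K == G :> {set gT}).

Lemma comax_adj_irr : irreflexive comax_adj.
Proof. by move=> H; rewrite /comax_adj eqxx. Qed.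

Lemma comax_adj_sym : symmetric comax_adj.
Proof.
suff imp H K : comax_adj H K -> comax_adj K H.
  by move=> H K; apply/idP/idP; apply: imp.
case/andP=> neHK /eqP defG; rewrite /comax_adj eq_sym neHK /=.
have/comm_group_setP cHK : group_set (val H * val K) by rewrite defG groupP.
by rewrite -cHK defG.
Qed.

End ComaximalSubgroupGraph.

Arguments comax_adj {gT} G.

(* Main.v *)
Require Import Defs.
From mathcomp Require Import all_boot all_fingroup all_solvable.

(** Everything is decided by the maximal subgroups of [G].

    In a nilpotent group the maximal subgroups are normal, so any two distinct
    ones have product [G] ([nilpotent_maximal_mul]). Three distinct maximal
    subgroups thus form a triangle, and if the graph is bipartite then [G] has
    at most two of them ([bipartite_maximal_collision]). Such a [G] is cyclic:
    a group is never the union of two proper subgroups, so some element avoids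
    every maximal subgroup and hence generates [G]
    ([noncyclic_three_maximal]). A cyclic group has a maximal subgroup of index
    [p] for each prime divisor [p] of its order, so there are at most two such
    primes.

    Conversely, in a cyclic group the subgroups whose index is divisible by a
    prime [p] all lie in the one subgroup of index [p]
    ([cyclic_prime_index_subgroup]), so they are independent. If only [p] and
    [q] divide the order, then a proper subgroup whose index is prime to [p] has
    an index divisible by [q]; splitting the vertices according to whether [p]
    divides the index is therefore a bipartition. *)

Set Implicit Arguments.
Unset Strict Implicit.
Unset Printing Implicit Defensive.

Import GroupScope.

Lemma bipartite_no_triangle (T : finType) (e : rel T) (x y z : T) :
  bipartite e -> e x y -> e x z -> e y z -> False.
Proof.
case=> A [B [AB _ indA indB]] exy exz eyz.
have inAB t : (t \in A) || (t \in B) by rewrite -in_setU AB inE.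
have nA u v : e u v -> u \in A -> v \in A -> False.
  by move=> euv Au Av; move: (indA u v Au Av); rewrite euv.
have nB u v : e u v -> u \in B -> v \in B -> False.
  by move=> euv Bu Bv; move: (indB u v Bu Bv); rewrite euv.
case/orP: (inAB x) (inAB y) (inAB z) => [xA | xB] /orP[yA | yB] /orP[zA | zB];
  solve [exact: nA exy _ _ | exact: nB exy _ _ | exact: nA exz _ _
        | exact: nB exz _ _ | exact: nA eyz _ _ | exact: nB eyz _ _].
Qed.

Section MaximalSubgroups.

Variables (gT : finGroupType) (G : {group gT}).
Implicit Types H K M N : {group gT}.

(** If each of [M] and [N] has an element outside the other, the product of
    these two elements lies in neither. *)
Lemma proper_pair_avoid M N :
  M \proper G -> N \proper G -> exists x, [/\ x \in G, x \notin M & x \notin N].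
Proof.
move=> prM prN; have [sMG [g Gg Mg]] := properP prM.
have [sNG [h Gh Nh]] := properP prN.
have [Ng | ] := boolP (g \in N); last by exists g.
have [Mh | ] := boolP (h \in M); last by exists h.
exists (g * h); split; first exact: groupM.
  by rewrite groupMr.
by rewrite groupMl.
Qed.

(** In a nilpotent group a proper subgroup is strictly smaller than its
    normaliser, so by maximality the normaliser of [M] is [G]. *)
Lemma nilpotent_maximal_normal M : nilpotent G -> maximal M G -> M <| G.
Proof.
move=> nilG maxM; have prM := maxgroupp maxM.
rewrite /normal proper_sub //=; apply: contraLR (nilpotent_proper_norm nilG prM).
move=> nMG; have prN : 'N_G(M) \proper G.
  by rewrite properE subsetIl subsetI subxx.
have [_ maxP] := maxgroupP maxM.
by apply/negP=> prMN; move: (prMN); rewrite (maxP _ prN (proper_sub prMN)) properxx.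
Qed.

Lemma maximal_sub_eq M N : maximal M G -> maximal N G -> M \subset N -> M = N.
Proof.
move=> /maxgroupP[_ maxM] maxN sMN; apply/val_inj.
by rewrite /= (maxM N (maxgroupp maxN) sMN).
Qed.

Lemma nilpotent_maximal_mul M N :
  nilpotent G -> maximal M G -> maximal N G -> M != N -> M * N = G.
Proof.
move=> nilG maxM maxN neqMN.
apply: (mulg_normal_maximal (nilpotent_maximal_normal nilG maxM) maxM).
  exact: proper_sub (maxgroupp maxN).
apply: contra neqMN => sNM; rewrite eq_sym; apply/eqP.
exact: (maximal_sub_eq maxN maxM).
Qed.

(** A maximal subgroup can fail to be a vertex only by being trivial, and then
    it is contained in every other one, hence is the only one. *)
Lemma maximal_comax_vertex M N :
  maximal M G -> maximal N G -> M != N -> (M :!=: 1) && (M \proper G).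
Proof.
move=> maxM maxN neqMN; rewrite (maxgroupp maxM) andbT.
apply: contra neqMN => /eqP M1; apply/eqP; apply: maximal_sub_eq => //.
by rewrite M1 sub1G.
Qed.

Lemma bipartite_maximal_collision M1 M2 M3 :
    nilpotent G -> bipartite (comax_adj G) ->
    maximal M1 G -> maximal M2 G -> maximal M3 G ->
  [|| M1 == M2, M1 == M3 | M2 == M3].
Proof.
move=> nilG bipG max1 max2 max3; apply: contraT.
case/norP=> ne12 /norP[ne13 ne23].
have v1 := maximal_comax_vertex max1 max2 ne12.
have v2 := maximal_comax_vertex max2 max3 ne23.
have v3 : (M3 :!=: 1) && (M3 \proper G).
  by apply: maximal_comax_vertex max3 max1 _; rewrite eq_sym.
have adj M N (vM : (M :!=: 1) && (M \proper G))
    (vN : (N :!=: 1) && (N \proper G)) :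
    maximal M G -> maximal N G -> M != N ->
    comax_adj G (exist _ M vM) (exist _ N vN).
  move=> maxM maxN neqMN; rewrite /comax_adj -val_eqE /= neqMN /=.
  by rewrite nilpotent_maximal_mul.
by case: (bipartite_no_triangle bipG (adj _ _ v1 v2 max1 max2 ne12)
  (adj _ _ v1 v3 max1 max3 ne13) (adj _ _ v2 v3 max2 max3 ne23)).
Qed.

(** Each cyclic subgroup is proper, so every element lies in a maximal subgroup;
    each new one is obtained from an element avoiding the previous ones. *)
Lemma noncyclic_three_maximal :
  ~~ cyclic G -> exists M1 M2 M3 : {group gT},
    [/\ maximal M1 G, maximal M2 G & maximal M3 G]
    /\ ~~ [|| M1 == M2, M1 == M3 | M2 == M3].
Proof.
move=> ncG.
have maxOf x : x \in G -> exists2 M : {group gT}, maximal M G & x \in M.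
  move=> Gx; have sxG : <[x]> \subset G by rewrite cycle_subG.
  have prx : <[x]> \proper G.
    rewrite properEneq sxG andbT; apply: contra ncG => /eqP <-.
    exact: cycle_cyclic.
  have [M maxM sxM] := @maxgroup_exists _ (fun H => H \proper G) _ prx.
  by exists M => //; rewrite -cycle_subG.
have [M1 max1 _] := maxOf 1 (group1 G).
have pr1 := maxgroupp max1.
have [x [Gx nM1x _]] := proper_pair_avoid pr1 pr1.
have [M2 max2 M2x] := maxOf x Gx.
have [y [Gy nM1y nM2y]] := proper_pair_avoid pr1 (maxgroupp max2).
have [M3 max3 M3y] := maxOf y Gy.
exists M1, M2, M3; split=> //; rewrite !negb_or; apply/and3P; split.
- by apply: contraNneq nM1x => ->.
- by apply: contraNneq nM1y => ->.
- by apply: contraNneq nM2y => ->.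
Qed.

(** Subgroups of a cyclic group are ordered by divisibility of their orders, so
    the one of index [p] contains all those of index divisible by [p]. *)
Lemma cyclic_prime_index_subgroup p :
    cyclic G -> prime p -> p %| #|G| ->
  exists2 M : {group gT}, maximal M G /\ #|G : M| = p
    & forall H, H \subset G -> p %| #|G : H| -> H \subset M.
Proof.
move=> cycG p_pr p_dv; have [x defG] := cyclicP cycG.
pose M : {group gT} := <[x ^+ p]>%G.
have sMG : M \subset G by rewrite /= defG cycleX.
have p_gt0 := prime_gt0 p_pr.
have oM : (#|M| * p)%N = #|G|.
  by rewrite defG /= -!orderE orderXdiv ?divnK // orderE -defG.
have iM : #|G : M| = p.
  by apply/eqP; rewrite -(eqn_pmul2l (cardG_gt0 M)) Lagrange // oM.
exists M => [|H sHG p_dvH].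
  by split=> //; apply: p_index_maximal; rewrite ?iM.
rewrite -(cardSg_cyclic cycG sHG sMG) -(dvdn_pmul2r p_gt0) oM.
by rewrite -(Lagrange sHG) dvdn_pmul2l ?cardG_gt0.
Qed.

Lemma cyclic_bipartite_primes :
    nilpotent G -> cyclic G -> bipartite (comax_adj G) ->
  size (primes #|G|) <= 2.
Proof.
move=> nilG cycG bipG.
case def_ps: (primes #|G|) => [|p [|q [|r s]]] //.
have maxOf t : t \in [:: p, q, r & s] ->
    exists2 M : {group gT}, maximal M G & #|G : M| = t.
  rewrite -def_ps mem_primes => /and3P[t_pr _ t_dv].
  by have [M [maxM iM] _] := cyclic_prime_index_subgroup cycG t_pr t_dv; exists M.
have [|M1 max1 i1] := maxOf p; first by rewrite !inE eqxx.
have [|M2 max2 i2] := maxOf q; first by rewrite !inE eqxx orbT.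
have [|M3 max3 i3] := maxOf r; first by rewrite !inE eqxx !orbT.
have := bipartite_maximal_collision nilG bipG max1 max2 max3.
have := primes_uniq #|G|; rewrite def_ps /= !inE.
case/and3P=> /norP[nepq /norP[nepr _]] /norP[neqr _] _.
case/or3P=> /eqP eqM; move: i1 i2 i3; rewrite eqM => i1 i2 i3.
- by move: nepq; rewrite -i1 i2 eqxx.
- by move: nepr; rewrite -i1 i3 eqxx.
- by move: neqr; rewrite -i2 i3 eqxx.
Qed.

(** Both subgroups lie in the proper subgroup of index [p], and so does their
    product. *)
Lemma cyclic_mul_neq p H K :
    cyclic G -> prime p -> H \subset G -> K \subset G ->
    p %| #|G : H| -> p %| #|G : K| -> H * K != G.
Proof.
move=> cycG p_pr sHG sKG pH pK.
have p_dv : p %| #|G| := dvdn_trans pH (dvdn_indexg G H).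
have [M [maxM _] inM] := cyclic_prime_index_subgroup cycG p_pr p_dv.
apply: contraTneq (maxgroupp maxM) => defG.
by rewrite properE -defG mul_subG ?inM ?andbF.
Qed.

Lemma cyclic_two_primes_bipartite p q :
    cyclic G -> prime p -> prime q ->
    {subset primes #|G| <= [:: p; q]} -> bipartite (comax_adj G).
Proof.
move=> cycG p_pr q_pr sub_pq.
pose A := [set h : comax_vertex G | p %| #|G : val h|].
have indep (r : nat) (C : {set comax_vertex G}) :
    prime r -> (forall h, h \in C -> r %| #|G : val h|) ->
    independent (comax_adj G) C.
  move=> r_pr rC H K /rC rH /rC rK; rewrite negb_and; apply/orP; right.
  have [_ /proper_sub sHG] := andP (valP H).
  have [_ /proper_sub sKG] := andP (valP K).
  exact: cyclic_mul_neq cycG r_pr sHG sKG rH rK.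
exists A, (~: A); split; first exact: setUCr.
- by rewrite -setI_eq0 setICr.
- by apply: indep p_pr _ => H; rewrite inE.
apply: indep q_pr _ => H; rewrite !inE => npH.
have [_ prH] := andP (valP H).
have i_gt1 : 1 < #|G : val H| by rewrite indexg_gt1 proper_subn.
have r_pr := pdiv_prime i_gt1; have r_dv := pdiv_dvd #|G : val H|.
have: pdiv #|G : val H| \in primes #|G|.
  by rewrite mem_primes r_pr cardG_gt0 (dvdn_trans r_dv (dvdn_indexg _ _)).
move/sub_pq; rewrite !inE => /orP[] /eqP def_r; rewrite def_r in r_dv => //.
by rewrite r_dv in npH.
Qed.

End MaximalSubgroups.

Lemma two_primes_factorization n :
    0 < n -> size (primes n) <= 2 ->
  exists p q a b : nat,
    [/\ prime p, prime q, p <> q & n = (p ^ a)%N \/ n = (p ^ a * q ^ b)%N].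
Proof.
move=> n_gt0.
have def_n := prod_prime_decomp n_gt0.
rewrite prime_decompE big_map /= in def_n.
have ps_pr : all prime (primes n).
  by apply/allP=> t; rewrite mem_primes => /andP[].
move: (primes_uniq n) ps_pr def_n.
case: (primes n) => [|p [|q [|r s]]] //=; rewrite ?big_cons big_nil ?muln1.
- by move=> _ _ -> _; exists 2, 3, 0, 0; split=> //; left.
- move=> _ /andP[p_pr _] def_n _.
  (* any prime other than p serves as the second one *)
  have [q ltpq q_pr] := prime_above p.
  exists p, q, (logn p n), 0; split=> //; last by left.
  by move=> eqpq; rewrite eqpq ltnn in ltpq.
- rewrite inE andbT => nepq /and3P[p_pr q_pr _] def_n _.
  by exists p, q, (logn p n), (logn q n); split=> //; [apply/eqP | right].
Qed.

Theorem theorem3p7 (gT : finGroupType) (G : {group gT}) :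
  nilpotent G ->
  bipartite (comax_adj G) <->
  (cyclic G /\
   exists p q a b : nat,
     [/\ prime p, prime q, p <> q
       & #|G| = (p ^ a)%N \/ #|G| = (p ^ a * q ^ b)%N]).
Proof.
move=> nilG; split=> [bipG | [cycG [p [q [a [b [p_pr q_pr _ oG]]]]]]].
  have cycG : cyclic G.
    apply: contraT => /noncyclic_three_maximal[M1 [M2 [M3 [[max1 max2 max3]]]]].
    by rewrite (bipartite_maximal_collision nilG bipG).
  split=> //; apply: two_primes_factorization; first exact: cardG_gt0.
  exact: cyclic_bipartite_primes.
apply: (cyclic_two_primes_bipartite cycG p_pr q_pr) => r.
rewrite mem_primes => /and3P[r_pr _]; rewrite !inE.
have dvX s c : prime s -> r %| s ^ c -> r == s.
  by move=> s_pr; rewrite Euclid_dvdX // dvdn_prime2 // => /andP[].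
case: oG => ->; first by move/(dvX _ _ p_pr)->.
by rewrite Euclid_dvdM // => /orP[/(dvX _ _ p_pr) | /(dvX _ _ q_pr)] ->;
  rewrite ?orbT.
Qed.
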